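(* Let $\phi:\mathbb{N}\to\mathbb{R}^{+}$ be an arbitrary positive function, let $F(\phi)=\{x\in(0,1]: d_n(x)\ge \phi(n)\text{ for infinitely many } n\}$, and let $\alpha:=\liminf_{n\to\infty}\frac{\phi(n)}{n}\in[0,+\infty]$. Then $$\dim_{\mathrm{H}}F(\phi)=\begin{cases} s(\alpha), & \text{if } 0\le\alpha<\infty,\\ 0, & \text{if }\alpha=+\infty,\end{cases}$$ where, for $0\le\alpha<\infty$, $s(\alpha)$ is the unique real solution $s$ of the equation $\sum_{k=1}^{\infty}\left(\frac{1}{2^{\alpha}2^{k}}\right)^{s}=1$.
   Context: $\mathbb{N}=\{1,2,3,\dots\}$; $\dim_{\mathrm{H}}$ denotes Hausdorff dimension. Every $x\in(0,1]$ has a unique expansion $x=\sum_{i=1}^{\infty}2^{-(d_1(x)+d_2(x)+\cdots+d_i(x))}$ with all $d_i(x)\in\mathbb{N}$ (the power-2-decaying Gauss-like expansion); this defines the digit functions $d_i:(0,1]\to\mathbb{N}$. Equivalently, with $T:(0,1]\to(0,1]$ given by $Tx=2^nx-1$ for $x\in(2^{-n},2^{-(n-1)}]$, $n\in\mathbb{N}$, the digit $d_i(x)$ is the unique $n\in\mathbb{N}$ with $T^{i-1}x\in(2^{-n},2^{-(n-1)}]$. *)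

(* Defs.v *)
From mathcomp Require Import all_boot all_order all_algebra.
From mathcomp Require Import all_classical all_reals all_analysis.

Set Implicit Arguments.
Unset Strict Implicit.
Unset Printing Implicit Defensive.

Import Order.TTheory GRing.Theory Num.Theory.
Import numFieldNormedType.Exports.

Local Open Scope classical_set_scope.
Local Open Scope ring_scope.

(* The diameter of the empty set is -oo; gauge gives the empty set the
   contribution 0 for every exponent s, including s = 0. *)
Definition ediam (R : realType) (U : set R) : \bar R :=
  ereal_sup [set `|p.1 - p.2|%:E | p in U `*` U].

Definition gauge (R : realType) (s : R) (U : set R) : \bar R :=
  if U == set0 then 0%E else (ediam U `^ s)%E.

Definition delta_cover (R : realType) (delta : R) (A : set R) :
    set (nat -> set R) :=
  [set U | (forall i, (ediam (U i) <= delta%:E)%E) /\ A `<=` \bigcup_i U i].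

Definition hausdorff_premeasure (R : realType) (s delta : R) (A : set R) :
    \bar R :=
  ereal_inf [set (\sum_(0 <= i <oo) gauge s (U i))%E
            | U in delta_cover delta A].

(* The supremum over delta > 0 is the limit as delta tends to 0, since
   hausdorff_premeasure is nonincreasing in delta. *)
Definition hausdorff_measure (R : realType) (s : R) (A : set R) : \bar R :=
  ereal_sup [set hausdorff_premeasure s delta A
            | delta in [set delta : R | 0 < delta]].

Definition hausdorff_dim (R : realType) (A : set R) : \bar R :=
  ereal_inf [set s%:E | s in [set s : R | 0 <= s /\ hausdorff_measure s A = 0%E]].

(* Digit sequences are indexed from 1; the value at index 0 is irrelevant. *)
Definition is_expansion (R : realType) (x : R) (d : nat -> nat) : Prop :=
  (forall i, (0 < i)%N -> (0 < d i)%N) /\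
  (fun n => \sum_(1 <= i < n.+1) (2^-1 : R) ^+ (\sum_(1 <= j < i.+1) d j)%N)
    @ \oo --> x.

(* For 0 < x <= 1 the expansion exists and is unique at indices >= 1, so the
   default value (used only outside this interval) and the choice made by xget
   do not matter. *)
Definition digit (R : realType) (n : nat) (x : R) : nat :=
  xget (fun=> 0%N) [set d | is_expansion x d] n.

Definition limsup_digits (R : realType) (phi : nat -> R) : set R :=
  [set x | 0 < x <= 1 /\
     infinite_set [set n : nat | (0 < n)%N /\ phi n <= (digit n x)%:R]].

(* For s <= 0 the left-hand side is +oo. *)
Definition dim_equation (R : realType) (a s : R) : Prop :=
  (\sum_(1 <= k <oo) (((2 `^ a * 2 ^+ k)^-1) `^ s)%:E = 1 :> \bar R)%E.

(* Main.v *)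
Require Import Defs.
From mathcomp Require Import all_boot all_order all_algebra.
From mathcomp Require Import all_classical all_reals all_analysis.
From mathcomp Require Import ring lra zify.
Import Order.TTheory GRing.Theory Num.Theory.
Import numFieldNormedType.Exports.
Local Open Scope classical_set_scope.
Local Open Scope ring_scope.

(** The cylinder of digits [d_1, ..., d_n] has length [2^-(d_1 + ... + d_n)], and
    [s] solves the dimension equation iff [0 < s] and [2^-((a+1)s) + 2^-s = 1].

    Upper bound: for [t > s] put [b := (a+1)s/t - 1 < a], so that [phi n >= b n]
    eventually.  The points whose [n]-th digit is at least [b n] are covered by one
    interval for each word of [n - 1] digits, and the sum of the [t]-th powers of
    their lengths factors into a geometric term of ratio [2^-((b+1)t)/(1 - 2^-t) < 1].

    Lower bound: for [0 < t < s] the same formula gives [beta > a].  Prescribe the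
    digit [trunc (phi n) + 2] at a sparse infinite set of positions with
    [phi n < beta n], spaced so that the sum of the prescribed digits never exceeds
    [beta] times the number of free positions, and let [y] in [(0,1]] choose the free
    digits through a bounded-alphabet expansion giving the digit [k] a weight at most
    [2^-t(beta+k)].  Then [y] is a [t]-Hoelder function of the resulting point, and
    the countable subadditivity of Lebesgue measure bounds the Hausdorff sums from
    below. *)

Set Implicit Arguments.
Unset Strict Implicit.
Unset Printing Implicit Defensive.

(** * Expansions *)

Definition dsum (d : nat -> nat) (n : nat) : nat := (\sum_(1 <= j < n.+1) d j)%N.

Definition psum (R : realType) (d : nat -> nat) (n : nat) : R :=
  \sum_(1 <= i < n.+1) 2^-1 ^+ dsum d i.

Section Expansion.
Context {R : realType}.
Implicit Types (d e : nat -> nat) (x : R).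

Lemma dsumS d n : dsum d n.+1 = (dsum d n + d n.+1)%N.
Proof. by rewrite /dsum big_nat_recr. Qed.

Lemma psumS d n : psum R d n.+1 = psum R d n + 2^-1 ^+ dsum d n.+1.
Proof. by rewrite /psum big_nat_recr. Qed.

Lemma eq_dsum d e n : (forall i, (0 < i <= n)%N -> d i = e i) -> dsum d n = dsum e n.
Proof. by move=> de; apply: eq_big_nat => i; rewrite ltnS => /de. Qed.

Lemma eq_psum d e n :
  (forall i, (0 < i <= n)%N -> d i = e i) -> psum R d n = psum R e n.
Proof.
move=> de; apply: eq_big_nat => i /andP[i0]; rewrite ltnS => ile.
by congr (_ ^+ _); apply: eq_dsum => j /andP[j0 ji]; rewrite de// j0 (leq_trans ji).
Qed.

Lemma leq_dsum d n : (forall i, (0 < i)%N -> (0 < d i)%N) -> (n <= dsum d n)%N.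
Proof.
move=> d0; elim: n => // n IH; rewrite dsumS; have := d0 n.+1 isT; lia.
Qed.

Lemma half_exp_gt0 n : 0 < 2^-1 ^+ n :> R.
Proof. by rewrite exprn_gt0// invr_gt0. Qed.

Lemma ler_half_exp m n : (m <= n)%N -> 2^-1 ^+ n <= 2^-1 ^+ m :> R.
Proof. by move=> mn; apply: ler_wiXn2l => //; lra. Qed.

Lemma double_half_exp n : 2^-1 ^+ n = 2^-1 ^+ n.+1 + 2^-1 ^+ n.+1 :> R.
Proof. by rewrite exprS; field. Qed.

Lemma psum_lt d n : psum R d n < psum R d n.+1.
Proof. by rewrite psumS ltrDl half_exp_gt0. Qed.

Lemma psum_homo d : {homo psum R d : m n / (m <= n)%N >-> m <= n}.
Proof. by apply/nondecreasing_seqP => n; apply/ltW/psum_lt. Qed.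

Lemma psum_ub_le d : (forall i, (0 < i)%N -> (0 < d i)%N) ->
  forall m n, (m <= n)%N -> psum R d n + 2^-1 ^+ dsum d n <= psum R d m + 2^-1 ^+ dsum d m.
Proof.
move=> d0; apply/(@nonincreasing_seqP _ _ (fun n => psum R d n + 2^-1 ^+ dsum d n)) => n.
rewrite psumS -addrA lerD2l.
have /ler_half_exp : (dsum d n + 1 <= dsum d n.+1)%N by rewrite dsumS leq_add2l d0.
by rewrite (double_half_exp (dsum d n)) addn1; lra.
Qed.

(** These are the ends of the cylinder of the first [n] digits; the left end is excluded because
    every further term is positive. *)
Lemma expansion_bounds x d : is_expansion x d ->
  forall n, psum R d n < x <= psum R d n + 2^-1 ^+ dsum d n.
Proof.
move=> [d0 dx] n.
have cvx : psum R d @ \oo --> x by exact: dx.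
have limx : limn (psum R d) = x by apply/cvg_lim.
apply/andP; split.
  rewrite (lt_le_trans (psum_lt d n))// -limx.
  apply: nondecreasing_cvgn_le; first exact: psum_homo.
  by apply/cvg_ex; exists x.
rewrite -limx; apply: limr_le; first by apply/cvg_ex; exists x.
near=> m; apply: (@le_trans _ _ (psum R d m + 2^-1 ^+ dsum d m)).
  by rewrite lerDl ltW// half_exp_gt0.
by apply: psum_ub_le => //; near: m; exact: nbhs_infty_ge.
Unshelve. all: by end_near. Qed.

Lemma expansion_exists d : (forall i, (0 < i)%N -> (0 < d i)%N) ->
  is_expansion (limn (psum R d)) d.
Proof.
move=> d0; split=> //.
suff : cvgn (psum R d) by [].
apply: nondecreasing_is_cvgn; first exact: psum_homo.
exists 1 => _ [n _ <-].
have e1 : psum R d 0 + 2^-1 ^+ dsum d 0 = 1.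
  by rewrite /psum /dsum !big_geq// expr0 add0r.
have := psum_ub_le d0 (leq0n n); rewrite e1.
by apply: le_trans; rewrite lerDl ltW// half_exp_gt0.
Qed.

(** Twice the new term of [d] is at most the new term of [d'], so the cylinder of [x] ends no later
    than the left-open cylinder of [x'] begins. *)
Lemma expansion_lt x x' d d' n : is_expansion x d -> is_expansion x' d' ->
  (forall i, (0 < i <= n)%N -> d i = d' i) -> (d' n.+1 < d n.+1)%N -> x < x'.
Proof.
move=> xd xd' dd' lt_dd'.
have /andP[_] := expansion_bounds xd n.+1.
have /andP[+ _] := expansion_bounds xd' n.+1.
rewrite !psumS (eq_psum dd').
have /ler_half_exp : ((dsum d' n.+1).+1 <= dsum d n.+1)%N.
  by rewrite !dsumS (eq_dsum dd') -addnS leq_add2l.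
by rewrite (double_half_exp (dsum d' _)); lra.
Qed.

Lemma expansion_unique x d d' : is_expansion x d -> is_expansion x d' ->
  forall n, (0 < n)%N -> d n = d' n.
Proof.
move=> xd xd' n; elim/ltn_ind: n => -[//|n] IH _.
have dd' i : (0 < i <= n)%N -> d i = d' i by case/andP=> i0 ilen; apply: IH.
have [lt|lt|//] := ltngtP (d n.+1) (d' n.+1).
- have d'd i : (0 < i <= n)%N -> d' i = d i by move/dd'.
  by have := expansion_lt xd' xd d'd lt; rewrite ltxx.
- by have := expansion_lt xd xd' dd' lt; rewrite ltxx.
Qed.

Lemma digit_expansion x d n : is_expansion x d -> (0 < n)%N -> digit n x = d n.
Proof.
move=> xd n0; rewrite /digit; case: xgetP => [e _ xe|/(_ d)//].
exact: (expansion_unique xe xd).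
Qed.

(** The default sequence of [digit] is constantly 0, so a positive digit shows that an expansion was
    chosen. *)
Lemma digit_is_expansion x n : (0 < digit n x)%N -> is_expansion x (fun k => digit k x).
Proof.
by rewrite /digit; case: xgetP => [d dE xd _|//].
Qed.

(* A digit following the first disagreement keeps the two points apart: a
   bounded digit pushes the larger one up, a large common one pulls the smaller
   one down. *)
Lemma expansion_gap x x' d d' n M : is_expansion x d -> is_expansion x' d' ->
  (forall i, (0 < i <= n)%N -> d i = d' i) -> (d' n.+1 < d n.+1)%N ->
  (d' n.+1 <= M)%N -> (d' n.+2 <= M)%N \/ (1 < d n.+2)%N ->
  2^-1 ^+ (dsum d n + (M + M).+2) <= x' - x.
Proof.
move=> xd xd' dd' lt_dd' leM next.
have /andP[_ xle1] := expansion_bounds xd n.+1.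
have /andP[_ xle2] := expansion_bounds xd n.+2.
have /andP[lex1 _] := expansion_bounds xd' n.+1.
have /andP[lex2 _] := expansion_bounds xd' n.+2.
have lt_sum : ((dsum d' n.+1).+1 <= dsum d n.+1)%N.
  by rewrite !dsumS (eq_dsum dd') -addnS leq_add2l.
have dbl := double_half_exp (dsum d' n.+1).
have /ler_half_exp h1 := lt_sum.
case: next => [le2|gt2].
  have : (dsum d' n.+2 <= dsum d n + (M + M).+2)%N by rewrite !dsumS (eq_dsum dd'); lia.
  move/ler_half_exp; move: xle1 lex2; rewrite !psumS (eq_psum dd'); lra.
have /ler_half_exp h2 : ((dsum d' n.+1).+3 <= dsum d n.+2)%N.
  by rewrite (dsumS d n.+1); lia.
have /ler_half_exp h3 : ((dsum d' n.+1).+2 <= dsum d n + (M + M).+2)%N.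
  by rewrite !dsumS (eq_dsum dd'); lia.
have dbl1 := double_half_exp (dsum d' n.+1).+1.
have dbl2 := double_half_exp (dsum d' n.+1).+2.
move: xle2 lex1; rewrite !psumS (eq_psum dd'); lra.
Qed.

End Expansion.

(** * Hausdorff dimension *)

Section Hausdorff.
Context {R : realType}.
Implicit Types (A U : set R) (s t : R).

Lemma gauge_ge0 s U : (0 <= gauge s U)%E.
Proof. by rewrite /gauge; case: ifP => // _; exact: poweR_ge0. Qed.

Lemma gauge_set0 s : gauge s (@set0 R) = 0%E.
Proof. by rewrite /gauge eqxx. Qed.

Lemma le_dist_ediam U x y : U x -> U y -> (`|x - y|%:E <= ediam U)%E.
Proof. by move=> Ux Uy; apply: ereal_sup_ubound; exists (x, y). Qed.

Lemma ediam_le U l : (forall x y, U x -> U y -> `|x - y| <= l) -> (ediam U <= l%:E)%E.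
Proof.
move=> Ul; apply: ge_ereal_sup => _ [[x y] [/= Ux Uy] <-].
by rewrite lee_fin Ul.
Qed.

Lemma ediam_ge0 U : U !=set0 -> (0 <= ediam U)%E.
Proof. by move=> [x Ux]; have := le_dist_ediam Ux Ux; rewrite subrr normr0. Qed.

Lemma gauge_le s U l : 0 <= s -> 0 <= l ->
  (forall x y, U x -> U y -> `|x - y| <= l) -> (gauge s U <= (l `^ s)%:E)%E.
Proof.
move=> s0 l0 /ediam_le Ul; rewrite /gauge; case: eqVneq => [_|/set0P/ediam_ge0 U0].
  by rewrite lee_fin powR_ge0.
by rewrite -poweR_EFin gt0_ler_poweR// in_itv/= ?U0 ?lee_fin ?l0 ?leey.
Qed.

Lemma gauge_fin s U x l : 0 <= s -> (ediam U <= l%:E)%E -> U x ->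
  exists r, [/\ 0 <= r, forall y z, U y -> U z -> `|y - z| <= r
              & gauge s U = (r `^ s)%:E].
Proof.
move=> s0 Ul Ux; have U0 : U !=set0 by exists x.
have := ediam_ge0 U0; case E : (ediam U) Ul => [r||]// _; rewrite lee_fin => r0.
exists r; split=> //.
  by move=> y z Uy Uz; rewrite -lee_fin -E le_dist_ediam.
by rewrite /gauge E; case: eqVneq U0 => [->|_ _]; [case|rewrite poweR_EFin].
Qed.

Lemma nneseries_gauge_ge0 s (U : nat -> set R) :
  (0 <= \sum_(0 <= i <oo) gauge s (U i))%E.
Proof. by apply: nneseries_ge0 => i _ _; exact: gauge_ge0. Qed.

Lemma hausdorff_measure_eq0P s A : hausdorff_measure s A = 0%E <->
  forall delta e, 0 < delta -> 0 < e -> exists2 U : nat -> set R, delta_cover delta A U &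
    (\sum_(0 <= i <oo) gauge s (U i) < e%:E)%E.
Proof.
split=> [A0 delta e d0 e0|cov].
  have : (hausdorff_premeasure s delta A < e%:E)%E.
    apply: (@le_lt_trans _ _ 0%E); last by rewrite lte_fin.
    by rewrite -A0; apply: ereal_sup_ubound; exists delta.
  by move=> /ereal_inf_lt[_ [U AU <-] Ue]; exists U.
have pre0 delta : (0 <= hausdorff_premeasure s delta A)%E.
  by apply: le_ereal_inf_tmp => _ [U _ <-]; exact: nneseries_gauge_ge0.
apply/eqP; rewrite eq_le; apply/andP; split.
  apply: ge_ereal_sup => _ [delta /= d0 <-]; apply/lee_addgt0Pr => e e0.
  have [U AU /ltW Ue] := cov _ _ d0 e0; rewrite add0e; apply: le_trans Ue.
  by apply: ereal_inf_lbound; exists U.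
apply: (le_trans (pre0 1)); apply: ereal_sup_ubound; exists 1 => //=.
Qed.

Lemma hausdorff_dim_ge0 A : (0 <= hausdorff_dim A)%E.
Proof. by apply: le_ereal_inf_tmp => _ [s [s0 _] <-]; rewrite lee_fin. Qed.

Lemma hausdorff_dim_le s A : 0 <= s ->
  (forall t, s < t -> hausdorff_measure t A = 0%E) -> (hausdorff_dim A <= s%:E)%E.
Proof.
move=> s0 sA; apply/lee_addgt0Pr => e e0; apply: ereal_inf_lbound.
exists (s + e) => //; split; first by rewrite addr_ge0// ltW.
by apply: sA; rewrite ltrDl.
Qed.

(* Any real-valued map from A onto the unit interval which is t-Hoelder bounds
   the content of A from below; g is a right inverse of that map. *)
Lemma holder_cover t C (g : R -> R) (U : nat -> set R) : 0 <= t -> 0 <= C ->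
  (forall y z : R, 0 < y <= 1 -> 0 < z <= 1 -> `|y - z| <= C * `|g y - g z| `^ t) ->
  (forall i, (ediam (U i) <= 1%:E)%E) ->
  (forall y : R, 0 < y <= 1 -> exists i, U i (g y)) ->
  (1 <= (C + C)%:E * \sum_(0 <= i <oo) gauge t (U i))%E.
Proof.
move=> t0 C0 gC U1 gU.
(* [F i] is an interval about one parameter [c] with [g c] in [U i], of radius [C] times the [t]-th
   power of the diameter of [U i]; it is empty if there is no such [c]. *)
have /choice[F FP] i : exists V : set R, [/\ measurable V,
    (lebesgue_measure V <= (C + C)%:E * gauge t (U i))%E &
    forall y : R, 0 < y <= 1 -> U i (g y) -> V y].
  have CC0 : 0 <= C + C by rewrite addr_ge0.
  have [[c [c01 Uc]]|noc] := pselect (exists c, 0 < c <= 1 /\ U i (g c)); last first.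
    exists set0; split=> //; first by rewrite measure0 mule_ge0// gauge_ge0.
    by move=> y y01 Uy; apply: noc; exists y.
  have [r [r0 Ur ->]] := gauge_fin t0 (U1 i) Uc.
  pose h := C * r `^ t.
  have h0 : 0 <= h by rewrite mulr_ge0// powR_ge0.
  exists `[c - h, c + h]%classic; split=> //.
    rewrite lebesgue_measure_itv/=; case: ifP => _.
      by rewrite -EFinD -EFinM lee_fin /h mulrDl; lra.
    by rewrite mule_ge0// lee_fin powR_ge0.
  move=> y y01 Uy /=; rewrite in_itv/= -ler_distlC (le_trans (gC _ _ c01 y01))//.
  by rewrite ler_wpM2l// ge0_ler_powR// ?nnegrE// Ur.
have : (lebesgue_measure (`]0%R, 1%R]%classic : set R)
    <= \sum_(0 <= i <oo) lebesgue_measure (F i))%E.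
  apply: measure_sigma_subadditive => //; first by move=> i; case: (FP i).
  move=> y /=; rewrite in_itv/= => y01; have [i Ui] := gU y y01.
  by exists i => //; case: (FP i) => _ _; apply.
rewrite lebesgue_measure_itv/= lte_fin ltr01 sube0 => /le_trans; apply.
rewrite -nneseriesZl; last by move=> i _; exact: gauge_ge0.
by apply: lee_nneseries => [i _ _|i _]; [exact: measure_ge0|case: (FP i)].
Qed.

Lemma hausdorff_dim_ge s A : 0 < s ->
  (forall t, 0 < t < s -> exists C (g : R -> R), [/\ 0 <= C,
    forall y : R, 0 < y <= 1 -> A (g y) &
    forall y z : R, 0 < y <= 1 -> 0 < z <= 1 -> `|y - z| <= C * `|g y - g z| `^ t]) ->
  (s%:E <= hausdorff_dim A)%E.
Proof.
move=> s0 As; apply: le_ereal_inf_tmp => _ [r [r0 /hausdorff_measure_eq0P Ar] <-].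
(* The midpoint [t] is positive even when [r] is 0, so sets of diameter 0 contribute nothing at
   exponent [t]; for diameters in [(0, 1]], [t >= r] compares the gauges. *)
rewrite lee_fin leNgt; apply/negP => rs; pose t := (r + s) / 2.
have [|C [g [C0 gA gC]]] := As t; first by rewrite /t; lra.
have [|U [U1 AU] Ue] := Ar 1 (C + C + 1)^-1 ltr01; first by rewrite invr_gt0; lra.
have t0 : 0 <= t by rewrite /t; lra.
have gU (y : R) : 0 < y <= 1 -> exists i, U i (g y).
  by move=> y01; have [i _ Ui] := AU _ (gA _ y01); exists i.
have := holder_cover t0 C0 gC U1 gU; apply/negP; rewrite -ltNge.
have UU : (\sum_(0 <= i <oo) gauge t (U i) <= \sum_(0 <= i <oo) gauge r (U i))%E.
  apply: lee_nneseries => [i _ _|i _]; first exact: gauge_ge0.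
  rewrite /gauge; case: eqVneq => // /set0P U0.
  have := ediam_ge0 U0; move: (U1 i); case: (ediam (U i)) => [d||]//; rewrite !lee_fin => d1 d0.
  have [->|dn0] := eqVneq d 0; last by rewrite ger_powR// ?lt_neqAle ?(eq_sym 0) ?dn0 ?d0// /t; lra.
  by rewrite powR0 ?powR_ge0// gt_eqF// /t; lra.
apply: (@le_lt_trans _ _ ((C + C)%:E * ((C + C + 1)^-1)%:E)%E).
  by rewrite lee_wpmul2l ?lee_fin ?addr_ge0// (le_trans UU)// ltW.
by rewrite -EFinM lte_fin ltr_pdivrMr; lra.
Qed.

End Hausdorff.

(** * The dimension equation *)

Section PowersOfTwo.
Context {R : realType}.
Implicit Types x y e q : R.

Lemma pow2D x y : 2 `^ (x + y) = 2 `^ x * 2 `^ y.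
Proof. by rewrite powRD// pnatr_eq0 implybT. Qed.

Lemma pow2_gt0 x : 0 < 2 `^ x.
Proof. by rewrite powR_gt0. Qed.

Lemma pow2E x : 2 `^ x = expR (x * ln 2).
Proof. by rewrite /powR pnatr_eq0. Qed.

Lemma ltr_pow2 x y : (2 `^ x < 2 `^ y) = (x < y).
Proof. by rewrite !pow2E ltr_expR ltr_pM2r// ln_gt0// ltr1n. Qed.

Lemma ler_pow2 x y : (2 `^ x <= 2 `^ y) = (x <= y).
Proof. by rewrite leNgt ltr_pow2 -leNgt. Qed.

Lemma half_expE n : 2^-1 ^+ n = 2 `^ (- n%:R) :> R.
Proof. by rewrite powR_invn// exprVn. Qed.

Lemma pow2X x n : (2 `^ x) ^+ n = 2 `^ (x * n%:R).
Proof. by rewrite powRrM powR_mulrn// powR_ge0. Qed.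

Lemma pow2N1 : 2 `^ (- 1) = 2^-1 :> R.
Proof. by rewrite powR_inv1. Qed.

Lemma pow2N_lt1 x : 0 < x -> 2 `^ (- x) < 1.
Proof. by move=> x0; rewrite -[X in _ < X](powRr0 2) ltr_pow2 oppr_lt0. Qed.

Lemma exp_small q e : 0 <= q -> q < 1 -> 0 < e ->
  exists N, forall n, (N <= n)%N -> q ^+ n < e.
Proof.
move=> q0 q1 e0; have : geometric 1 q @ \oo --> 0 by apply: cvg_geometric; rewrite ger0_norm.
move=> /cvgr0_norm_lt /(_ _ e0)[N _ Nq]; exists N => n /Nq /=.
by rewrite mul1r ger0_norm// exprn_ge0.
Qed.

End PowersOfTwo.

Section DimEquation.
Context {R : realType}.
Implicit Types a s t : R.

(** For [s > 0], summing the geometric series turns the dimension equation into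
    [dim_fun a s = 1]. *)
Definition dim_fun a s : R := 2 `^ (- ((a + 1) * s)) + 2 `^ (- s).

Lemma dim_fun_lt a s t : 0 <= a -> s < t -> dim_fun a t < dim_fun a s.
Proof.
move=> a0 st; rewrite /dim_fun; apply: ltrD; rewrite ltr_pow2 ltrN2// ltr_pM2l//.
by rewrite ltr_wpDl.
Qed.

Lemma dim_equation_term a s k : ((2 `^ a * 2 ^+ k)^-1) `^ s =
  2 `^ (- (a * s)) * (2 `^ (- s)) ^+ k.
Proof.
rewrite -powR_mulrn// -pow2D -powRN -powRrM pow2X -pow2D; congr (_ `^ _).
by ring.
Qed.

Lemma dim_equationP a s : 0 <= a -> dim_equation a s <-> 0 < s /\ dim_fun a s = 1.
Proof.
move=> a0; rewrite /dim_equation; under eq_eseriesr do rewrite dim_equation_term.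
set c := 2 `^ (- (a * s)); set q := 2 `^ (- s).
have [s_gt0|s_le0] := ltP 0 s; last first.
  (* For [s <= 0] every term is at least 1, so two terms already give 2. *)
  split=> [sum1|[]]//; exfalso.
  have t1 k : 1 <= c * q ^+ k.
    rewrite /c /q pow2X -pow2D -[X in X <= _](powRr0 2) ler_pow2.
    have : 0 <= (a + k%:R) * - s by rewrite mulr_ge0 ?addr_ge0// oppr_ge0.
    lra.
  have : ((2 : R)%:E <= \sum_(1 <= k <oo) (c * q ^+ k)%:E)%E.
    apply: le_trans _ (@nneseries_lim_ge R _ xpredT 1 3 _).
      rewrite big_nat_recr//= big_nat_recr//= big_geq// add0e -EFinD lee_fin.
      by have := t1 1%N; have := t1 2%N; lra.
    by move=> k _ _; rewrite lee_fin (le_trans ler01).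
  by rewrite sum1 lee_fin leNgt ltr1n.
have q0 : 0 < q by rewrite pow2_gt0.
have q1 : q < 1 by rewrite pow2N_lt1.
have -> : (\sum_(1 <= k <oo) (c * q ^+ k)%:E)%E = (c * q / (1 - q))%:E.
  apply/cvg_lim => //; rewrite -(cvg_shiftS (fun n => \sum_(1 <= k < n) (c * q ^+ k)%:E)%E).
  rewrite (_ : (fun _ => _) = EFin \o series (geometric (c * q) q)); last first.
    apply/funext => n /=; rewrite sumEFin big_add1/=; congr (_%:E).
    by apply: eq_bigr => i _; rewrite /= exprS mulrA.
  by apply: cvg_EFin; [near=> n|apply: cvg_geometric_series; rewrite ger0_norm// ltW].
have -> : dim_fun a s = c * q + q.
  by rewrite /dim_fun /c /q -pow2D; congr (2 `^ _ + _); ring.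
have q1' : 1 - q != 0 by rewrite subr_eq0 gt_eqF.
split=> [sum1|[_ cq]].
  have {}sum1 : c * q / (1 - q) = 1 by apply: EFin_inj.
  by split=> //; rewrite -[c * q](divfK q1') sum1 mul1r subrK.
by congr (_%:E); apply: (mulIf q1'); rewrite divfK// mul1r -cq; ring.
Unshelve. all: by end_near. Qed.

Lemma dim_equation_exists a : 0 <= a -> exists! s, dim_equation a s.
Proof.
move=> a0.
have cf : continuous (dim_fun a).
  rewrite (_ : dim_fun a = fun s => expR (- ((a + 1) * ln 2) * s) + expR (- ln 2 * s)); last first.
    by apply/funext => s; rewrite /dim_fun !pow2E; congr (expR _ + expR _); ring.
  have ce k : continuous (fun s : R => expR (k * s)).
    move=> x; apply: (@continuous_comp _ _ _ ( *%R k) expR x); last exact: continuous_expR.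
    exact: mulrl_continuous.
  by move=> s; apply: cvgD; exact: ce.
have f0 : dim_fun a 0 = 2 by rewrite /dim_fun mulr0 oppr0 powRr0.
have f1 : dim_fun a 1 <= 1.
  rewrite /dim_fun mulr1 pow2N1 -lerBrDr (_ : 1 - 2^-1 = 2 `^ (- 1)); last by rewrite pow2N1; field.
  by rewrite ler_pow2 lerN2 lerDr.
have [|s] := @IVT R (dim_fun a) 0 1 1 ler01 (continuous_subspaceT cf).
  rewrite f0; apply/andP; split; first by rewrite ge_min f1 orbT.
  by rewrite le_max ler1n.
rewrite in_itv/= => /andP[s0 s1] fs.
have sgt0 : 0 < s.
  by rewrite lt_neqAle s0 andbT; apply: contra_eq_neq fs => <-; rewrite f0 pnatr_eq1.
exists s; split; first exact/dim_equationP.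
move=> t /dim_equationP -/(_ a0)[t0 ft]; have [st|ts|//] := ltgtP s t.
- by have := dim_fun_lt a0 st; rewrite fs ft ltxx.
- by have := dim_fun_lt a0 ts; rewrite fs ft ltxx.
Qed.

End DimEquation.

(** * Upper bound *)

Section WordSums.
Context {R : realType}.

Lemma sum_fibers (T : eqType) (h : T -> nat) (s : seq T) (F : T -> R) :
  exists J, \sum_(x <- s) F x = \sum_(0 <= j < J) \sum_(x <- s | h x == j) F x.
Proof.
pose J := (\max_(x <- s) h x).+1; exists J; rewrite big_mkord.
under [RHS]eq_bigr do rewrite big_mkcond.
rewrite exchange_big/=; apply: eq_big_seq => x xs.
have hJ : (h x < J)%N by rewrite ltnS; exact: leq_bigmax_seq.
rewrite (bigD1 (Ordinal hJ))//= eqxx big1 ?addr0// => j.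
by rewrite -val_eqE/= eq_sym => /negbTE ->.
Qed.

Context (f : nat -> R) (kappa : R).
Context (f_ge0 : forall j, 0 <= f j).
Context (f_le : forall J, \sum_(0 <= j < J) f j <= kappa).

Definition weight (w : seq nat) : R := \prod_(j <- w) f j.

(** Over all words of length [n] the sum would factor into the [n]-th power of the letter sum;
    grouping by the first letter gives the bound by induction. *)
Lemma sum_weight_le n (W : seq (seq nat)) : uniq W ->
  {in W, forall w, size w = n} -> \sum_(w <- W) weight w <= kappa ^+ n.
Proof.
have kappa0 : 0 <= kappa by have := f_le 0; rewrite big_geq.
elim: n W => [|n IH] W uW sW.
  have : {subset W <= [:: [::]]}.
    by move=> w /sW /size0nil ->; rewrite mem_head.
  move=> /(uniq_leq_size uW) /=; case: W uW sW => [|w [|//]] _ sW _.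
    by rewrite big_nil.
  by rewrite big_seq1 (size0nil (sW w (mem_head _ _))) /weight big_nil.
have [J ->] := sum_fibers (head 0%N) W weight.
rewrite exprS; apply: (@le_trans _ _ (\sum_(0 <= j < J) f j * kappa ^+ n)); last first.
  by rewrite -mulr_suml ler_wpM2r// exprn_ge0.
apply: ler_sum => j _; pose Wj := [seq w <- W | head 0%N w == j].
have headW w : w \in Wj -> w = j :: behead w.
  by rewrite mem_filter => /andP[/eqP wj /sW]; case: w wj => //= a w ->.
have -> : \sum_(w <- W | head 0%N w == j) weight w =
    f j * \sum_(w <- map behead Wj) weight w.
  rewrite -big_filter big_map mulr_sumr; apply: eq_big_seq => w /headW {1}->.
  by rewrite /weight big_cons.
apply: ler_wpM2l => //; apply: IH.
  rewrite map_inj_in_uniq ?filter_uniq// => v w /headW -> /headW -> /= -> //.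
by move=> _ /mapP[w wW ->]; rewrite size_behead; move: wW; rewrite mem_filter => /andP[_ /sW ->].
Qed.

Lemma weight_le w : weight w <= kappa ^+ size w.
Proof.
have := @sum_weight_le (size w) [:: w]; rewrite big_seq1; apply=> // v.
by rewrite inE => /eqP ->.
Qed.

(** Grouping by length leaves a geometric series. *)
Lemma sum_weight_tail_le N (W : seq (seq nat)) : kappa < 1 -> uniq W ->
  {in W, forall w, (N <= size w)%N} ->
  \sum_(w <- W) weight w <= kappa ^+ N / (1 - kappa).
Proof.
move=> kappa1 uW sW; have kappa0 : 0 <= kappa by have := f_le 0; rewrite big_geq.
have [J ->] := sum_fibers (fun w => size w - N)%N W weight.
apply: (@le_trans _ _ (\sum_(0 <= j < J) kappa ^+ N * kappa ^+ j)).
  apply: ler_sum => j _; rewrite -big_filter -exprD.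
  apply: sum_weight_le; first exact: filter_uniq.
  by move=> w; rewrite mem_filter => /andP[/eqP <- /sW]; lia.
rewrite -mulr_sumr ler_wpM2l ?exprn_ge0//.
have [->|kappan0] := eqVneq kappa 0.
  rewrite subr0 invr1; case: J => [|J]; first by rewrite big_geq.
  by rewrite big_nat_recl//= expr0 big1 ?addr0// => i _; rewrite exprS mul0r.
have := @geometric_le_lim R J 1 kappa ler01; rewrite mul1r ger0_norm//.
rewrite lt_neqAle eq_sym kappan0 kappa0 => /(_ isT kappa1); apply: le_trans.
by rewrite le_eqVlt; apply/orP; left; apply/eqP/eq_bigr => i _ /=; rewrite mul1r.
Qed.

End WordSums.

(** * Covers by word intervals *)

Section UpperBound.
Context {R : realType}.

(* The letters of a word count from 0 whereas digits count from 1. *)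
Definition word_digits (w : seq nat) (i : nat) : nat := (nth 0%N w i.-1).+1.

Lemma dsum_word_digits w : dsum (word_digits w) (size w) = (\sum_(j <- w) j.+1)%N.
Proof. by rewrite /dsum big_add1 [RHS](big_nth 0%N). Qed.

(* The points of the cylinder of [w] whose next digit [d] satisfies
   [b * (size w).+1 <= d] lie in [word_cover b w]. *)
Definition word_length (b : R) (w : seq nat) : R :=
  2 `^ (1 - (dsum (word_digits w) (size w))%:R - b * (size w).+1%:R).

Definition word_cover (b : R) (w : seq nat) : set R :=
  let p := psum R (word_digits w) (size w) in
  `]p, p + word_length b w]%classic.

(** The [t]-th power of [2^-(b + d)] for the digit [d = j + 1]: each letter carries its own share
    [b] of the threshold, which makes the weight multiplicative. *)
Definition digit_weight (t b : R) (j : nat) : R := 2 `^ (- (t * (b + j.+1%:R))).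

Lemma sum_digit_weight t b J : 0 < t ->
  \sum_(0 <= j < J) digit_weight t b j =
  2 `^ (- ((b + 1) * t)) * (1 - (2 `^ (- t)) ^+ J) / (1 - 2 `^ (- t)).
Proof.
move=> t0; have q1 := pow2N_lt1 t0; set q := 2 `^ (- t) in q1 *.
have -> : \sum_(0 <= j < J) digit_weight t b j = series (geometric (2 `^ (- ((b + 1) * t))) q) J.
  apply: eq_bigr => j _; rewrite /= /digit_weight /q pow2X -pow2D.
  by congr (_ `^ _); rewrite -natr1; ring.
by rewrite geometric_seriesE// lt_eqF.
Qed.

Lemma weight_digit_weight t b w : weight (digit_weight t b) w =
  2 `^ (- (t * (b * (size w)%:R + (\sum_(j <- w) j.+1)%:R))).
Proof.
rewrite /weight; elim: w => [|j w IH]; first by rewrite !big_nil !mulr0 addr0 mulr0 oppr0 powRr0.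
rewrite !big_cons IH /digit_weight -pow2D; congr (_ `^ _).
by rewrite natrD /= -[(size w).+1%:R]natr1; ring.
Qed.

(** The constant collects the factor 2 of the length and the share [b] of position [size w + 1],
    which has no letter in [w]. *)
Lemma word_length_powR t b w :
  word_length b w `^ t = 2 `^ (t * (1 - b)) * weight (digit_weight t b) w.
Proof.
rewrite weight_digit_weight /word_length -powRrM -pow2D dsum_word_digits.
by congr (_ `^ _); rewrite -[(size w).+1%:R]natr1; ring.
Qed.

(** The right end of the next cylinder lies twice [2^-dsum d n.+1] beyond [psum R d n], whence the
    summand 1 in the exponent of [word_length]. *)
Lemma word_cover_digit b x d n : is_expansion x d ->
  b * n.+1%:R <= (d n.+1)%:R ->
  word_cover b (mkseq (fun i => (d i.+1).-1) n) x.
Proof.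
move=> xd le_d; set w := mkseq _ _.
have wd i : (0 < i <= n)%N -> word_digits w i = d i.
  case: i => // i /andP[_ i_n]; rewrite /word_digits /= nth_mkseq// prednK//.
  by case: xd => + _; apply.
rewrite /word_cover /word_length size_mkseq (eq_psum wd) (eq_dsum wd)/= in_itv/=.
have /andP[-> _] := expansion_bounds xd n.
have /andP[_ /le_trans] := expansion_bounds xd n.+1; apply.
rewrite psumS -addrA lerD2l dsumS half_expE.
rewrite -[X in _ + X]mul1r -[X in X + _]mul1r -mulrDl -[X in X * _](powRr1 (ler0n _ 2)).
by rewrite -pow2D ler_pow2 natrD; lra.
Qed.

Lemma limsup_digits_null (phi : nat -> R) t b : 0 < t -> dim_fun b t < 1 ->
  (forall n, (0 < n)%N -> 0 < phi n) ->
  (exists N, forall n, (N <= n)%N -> b * n%:R <= phi n) ->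
  hausdorff_measure t (limsup_digits phi) = 0%E.
Proof.
move=> t0 bt phi0 [N0 bphi].
have q0 : 0 < 1 - 2 `^ (- t) by rewrite subr_gt0 pow2N_lt1.
pose kappa : R := 2 `^ (- ((b + 1) * t)) / (1 - 2 `^ (- t)).
have kappa0 : 0 <= kappa by rewrite divr_ge0// ltW// pow2_gt0.
have kappa1 : kappa < 1 by rewrite ltr_pdivrMr// mul1r; move: bt; rewrite /dim_fun; lra.
have f0 j : 0 <= digit_weight t b j by rewrite powR_ge0.
have fle J : \sum_(0 <= j < J) digit_weight t b j <= kappa.
  rewrite sum_digit_weight//; apply: ler_wpM2r; first by rewrite invr_ge0 ltW.
  by rewrite ler_piMr ?powR_ge0// gerBl exprn_ge0// powR_ge0.
apply/hausdorff_measure_eq0P => delta e delta0 e0.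
pose K : R := 2 `^ (t * (1 - b)).
have K0 : 0 < K by exact: pow2_gt0.
(* The first bound keeps the intervals of words of at least [N] letters within [delta], the second
   makes their [t]-sum less than [e]. *)
pose eta := Num.min (delta `^ t / K) (e * (1 - kappa) / (K + K)).
have eta0 : 0 < eta.
  by rewrite lt_min !divr_gt0 ?powR_gt0 ?mulr_gt0 ?subr_gt0 ?addr_gt0.
have [N Neta] := exp_small kappa0 kappa1 eta0.
have Kdelta n : (N <= n)%N -> K * kappa ^+ n <= delta `^ t.
  by move=> /Neta; rewrite lt_min => /andP[+ _]; rewrite ltr_pdivlMr// mulrC => /ltW.
have Ke : K * (kappa ^+ N / (1 - kappa)) < e.
  have := Neta N (leqnn N); rewrite lt_min => /andP[_].
  rewrite ltr_pdivlMr ?addr_gt0// => lt_e.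
  rewrite mulrA ltr_pdivrMr ?subr_gt0// (le_lt_trans _ lt_e)// mulrC ler_wpM2l ?exprn_ge0//.
  by rewrite lerDl ltW.
(* The cover is indexed by codes of words; a number coding no word, or a word of fewer than [N]
   letters, gets the empty set, of gauge 0. *)
pose V (o : option (seq nat)) : set R :=
  if o is Some w then if (N <= size w)%N then word_cover b w else set0 else set0.
have dist_cover w x y : word_cover b w x -> word_cover b w y -> `|x - y| <= word_length b w.
  by rewrite /word_cover /= !in_itv/= ler_norml; lra.
exists (fun i => V (pickle_inv i)).
  split=> [i|x [x01 infx]].
    case: (pickle_inv i) => [w|] /=; last by apply: ediam_le.
    case: ifP => [Nw|_]; last by apply: ediam_le.
    apply: ediam_le => x y xw yw; apply: le_trans (dist_cover _ _ _ xw yw) _.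
    rewrite leNgt; apply/negP => lt_delta.
    have := gt0_ltr_powR t0; move=> /(_ delta (word_length b w)).
    rewrite !nnegrE (ltW delta0) powR_ge0 => /(_ isT isT lt_delta).
    apply/negP; rewrite -leNgt word_length_powR (le_trans _ (Kdelta _ Nw))//.
    by apply: ler_wpM2l; [exact: ltW|exact: weight_le].
  have [n [n0 phin] ltn] : exists2 n, (0 < n)%N /\ phi n <= (digit n x)%:R & (N + N0 < n)%N.
    apply: contrapT => nex; apply: infx.
    apply: (@sub_finite_set _ _ `I_(N + N0).+1); last exact: finite_II.
    by move=> n /= nP; rewrite ltnS leqNgt; apply/negP => lt; apply: nex; exists n.
  (* Positivity of [phi n] makes the digit positive, which rules out the default 0. *)
  have xd : is_expansion x (fun k => digit k x).
    apply: (@digit_is_expansion _ _ n).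
    by rewrite -(ltr_nat R) (lt_le_trans (phi0 n n0)).
  case: n n0 phin ltn => // m _ phin ltm.
  exists (pickle (mkseq (fun i => (digit i.+1 x).-1) m)) => //=.
  rewrite pickleK_inv /= size_mkseq ifT; last by lia.
  by apply: word_cover_digit => //; apply: le_trans phin; apply: bphi; lia.
apply: le_lt_trans (_ : (K * (kappa ^+ N / (1 - kappa)))%:E < e%:E)%E; last by rewrite lte_fin.
apply: lime_le; first by apply: is_cvg_nneseries => i _ _; exact: gauge_ge0.
near=> L; pose W := [seq w <- pmap (@pickle_inv (seq nat)) (index_iota 0 L) | (N <= size w)%N].
apply: (@le_trans _ _ (\sum_(w <- W) K * weight (digit_weight t b) w)%:E); last first.
  rewrite lee_fin -mulr_sumr; apply: ler_wpM2l; first exact: ltW.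
  apply: sum_weight_tail_le => //.
    by rewrite filter_uniq// (pmap_uniq (@pickle_invK _))// iota_uniq.
  by move=> w; rewrite mem_filter => /andP[].
rewrite /W big_filter [in leRHS]big_mkcond/= big_pmap -sumEFin; apply: lee_sum => i _.
case: (pickle_inv i) => [w|] /=; last by rewrite gauge_set0.
case: ifP => _; last by rewrite gauge_set0.
rewrite -word_length_powR; apply: gauge_le; rewrite ?powR_ge0 ?ltW//.
exact: dist_cover.
Unshelve. all: by end_near. Qed.

End UpperBound.

(** * Lower bound *)

Section WeightedExpansion.
Context {R : realType}.

(** Cut [(0, 1]] into left-open pieces of lengths [a j / sigma], with [sigma] the sum of the
    weights; [J] picks the piece of [y] and [T] stretches it onto [(0, 1]]. As [sigma >= 1], the
    piece has length at most [a j]. *)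
Lemma weighted_expansion (a : nat -> R) (M : nat) : (forall j, 0 < a j) ->
  1 <= \sum_(0 <= j < M) a j ->
  exists (J : R -> nat) (T : R -> R), forall y, 0 < y <= 1 ->
    [/\ (J y < M)%N, 0 < T y <= 1 & forall z, 0 < z <= 1 -> J y = J z ->
      `|y - z| <= a (J y) * `|T y - T z|].
Proof.
move=> a0; set sigma := \sum_(0 <= j < M) a j => sigma1.
have sigma0 : 0 < sigma by rewrite (lt_le_trans ltr01).
pose c j := (\sum_(0 <= i < j) a i) / sigma.
have cS j : c j.+1 = c j + a j / sigma by rewrite /c big_nat_recr//= mulrDl.
have /choice[J JP] (y : R) : exists j, 0 < y <= 1 -> (j < M)%N /\ c j < y <= c j.+1.
  have [y01|//] := boolP (0 < y <= 1); last by exists 0%N.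
  have cM : exists j, y <= c j.
    by exists M; rewrite /c divff ?gt_eqF//; case/andP: y01.
  case: (ex_minnP cM) => -[|j] yc jmin.
    by move: yc; rewrite /c big_geq// mul0r leNgt; case/andP: y01 => ->.
  exists j => _; split; last by rewrite yc andbT ltNge; apply/negP => /jmin; rewrite ltnn.
  by apply: jmin; rewrite /c divff ?gt_eqF//; case/andP: y01.
pose T y := (y - c (J y)) / (a (J y) / sigma).
have as0 j : 0 < a j / sigma by rewrite divr_gt0.
have yE y : y = c (J y) + a (J y) / sigma * T y.
  by rewrite /T mulrC divfK ?gt_eqF// addrC subrK.
exists J, T => y y01; have [JM /andP[cy yc]] := JP y y01; split=> // [|z z01 Jyz].
  by rewrite /T divr_gt0 ?subr_gt0// ler_pdivrMr// mul1r lerBlDl -cS.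
rewrite {1}(yE y) {1}(yE z) -Jyz opprD addrACA subrr add0r -mulrBr normrM gtr0_norm//.
apply: ler_wpM2r => //; rewrite ler_pdivrMr// ler_peMr//; exact: ltW.
Qed.

End WeightedExpansion.

(** * Greedy placement of the prescribed digits *)

Section Schedule.
Context {R : realType} (beta : R) (m : nat -> nat).

(* [budget n] holds the total of the digits prescribed up to position [n] and the
   number of free positions; [m n] is prescribed as soon as [beta] times the
   number of free positions can pay for it. *)
Fixpoint budget (n : nat) : nat * nat :=
  if n is k.+1 then
    let s := budget k in
    if (s.1 + m k.+1)%:R <= beta * s.2%:R then ((s.1 + m k.+1)%N, s.2) else (s.1, s.2.+1)
  else (0%N, 0%N).

Definition forced (n : nat) : bool :=
  ((budget n.-1).1 + m n)%:R <= beta * (budget n.-1).2%:R.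

Lemma budgetS n : budget n.+1 =
  if forced n.+1 then ((budget n).1 + m n.+1, (budget n).2)%N
  else ((budget n).1, (budget n).2.+1)%N.
Proof. by []. Qed.

Context (beta0 : 0 <= beta).

Lemma budget_le n : (budget n).1%:R <= beta * (budget n).2%:R.
Proof.
elim: n => [|n IH]; first by rewrite mulr0.
rewrite budgetS; case: ifP => //= _; rewrite (le_trans IH)//.
by rewrite ler_wpM2l// ler_nat.
Qed.

(** Were no position after [N] prescribed, the prescribed total would stay fixed while the credit
    grows like [beta * n], until some [m n] becomes affordable. *)
Lemma forced_unbounded :
  (forall N (c : R), exists2 n, (N < n)%N & (m n)%:R + c <= beta * n%:R) ->
  forall N, exists2 n, (N < n)%N & forced n.
Proof.
move=> mP N; apply: contrapT => nex.
have free n : budget (N + n) = ((budget N).1, ((budget N).2 + n)%N).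
  elim: n => [|n IH]; first by rewrite !addn0; case: (budget N).
  rewrite addnS budgetS ifF ?IH ?addnS//; apply/negP => fn; apply: nex.
  by exists (N + n).+1 => //; rewrite ltnS leq_addr.
(* The constant covers the total already prescribed and the [N + 1] positions that may not count as
   free. *)
have [n Nn mn] := mP N ((budget N).1%:R + beta * N.+1%:R).
apply: nex; exists n => //; have -> : n = (N + (n - N.+1)).+1 by lia.
rewrite /forced /= free /=.
have -> : (N + (n - N.+1)).+1 = n by lia.
rewrite natrD; apply: (@le_trans _ _ (beta * (n%:R - N.+1%:R))); first lra.
by rewrite ler_wpM2l// natrD natrB// lerDr.
Qed.

End Schedule.

(** * Points with prescribed and free digits *)

Section HolderPoints.
Context {R : realType} (t beta : R) (M : nat) (m : nat -> nat).
Context (J : R -> nat) (T : R -> R).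
Context (t0 : 0 < t) (beta0 : 0 <= beta) (m1 : forall n, (1 < m n)%N).
Context (JT : forall y, 0 < y <= 1 ->
  [/\ (J y < M)%N, 0 < T y <= 1 & forall z, 0 < z <= 1 -> J y = J z ->
    `|y - z| <= digit_weight t beta (J y) * `|T y - T z|]).

(** The orbit waits at prescribed positions, so that [y] is spent on the free digits only. *)
Fixpoint orbit (y : R) (n : nat) : R :=
  if n is k.+1 then
    if forced beta m k.+1 then orbit y k else T (orbit y k)
  else y.

Definition orbit_digit (y : R) (n : nat) : nat :=
  if forced beta m n then m n else (J (orbit y n.-1)).+1.

Definition orbit_point (y : R) : R := limn (psum R (orbit_digit y)).

Lemma orbit01 y n : 0 < y <= 1 -> 0 < orbit y n <= 1.
Proof.
by move=> y01; elim: n => //= n IH; case: ifP => // _; have [] := JT IH.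
Qed.

Lemma orbit_digit_gt0 y n : (0 < orbit_digit y n)%N.
Proof. by rewrite /orbit_digit; case: ifP => // _; exact: ltnW. Qed.

Lemma orbit_digit_free y n : 0 < y <= 1 -> ~~ forced beta m n -> (orbit_digit y n <= M)%N.
Proof.
move=> y01 /negbTE fn; rewrite /orbit_digit fn.
by have [] := JT (orbit01 n.-1 y01).
Qed.

Lemma orbit_point_expansion y : is_expansion (orbit_point y) (orbit_digit y).
Proof. by apply: expansion_exists => i _; exact: orbit_digit_gt0. Qed.

(** Each free digit [d] contributes a factor [2^-(t (beta + d))], a prescribed one none; [dsum]
    minus the first component of [budget] is the total of the free digits. *)
Lemma orbit_contract y z n : 0 < y <= 1 -> 0 < z <= 1 ->
  (forall i, (0 < i <= n)%N -> orbit_digit y i = orbit_digit z i) ->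
  `|y - z| <= 2 `^ (- (t * (beta * (budget beta m n).2%:R - (budget beta m n).1%:R
                            + (dsum (orbit_digit y) n)%:R))) * `|orbit y n - orbit z n|.
Proof.
move=> y01 z01; elim: n => [_|n IH yz].
  by rewrite /dsum big_geq//= mulr0 subr0 addr0 mulr0 oppr0 powRr0 mul1r.
have {IH} := IH; move=> /(_ _)/le_trans; apply.
  by move=> i /andP[i0 i_n]; apply: yz; rewrite i0 leqW.
have := yz n.+1 (leqnn _); rewrite budgetS dsumS /orbit_digit /=.
case: ifP => /= [_ _|_ [Jyz]].
  rewrite le_eqVlt; apply/orP; left; apply/eqP; congr (2 `^ _ * _).
  by rewrite !natrD; ring.
have [_ _ /(_ _ (orbit01 n z01) Jyz)] := JT (orbit01 n y01).
move=> /(ler_wpM2l (powR_ge0 2 (- (t * (beta * (budget beta m n).2%:R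
  - (budget beta m n).1%:R + (dsum (orbit_digit y) n)%:R))))) /le_trans; apply.
rewrite mulrA /digit_weight -pow2D le_eqVlt; apply/orP; left; apply/eqP; congr (2 `^ _ * _).
by rewrite natrD -[(budget beta m n).2.+1%:R]natr1; ring.
Qed.

(** By [budget_le] the gain [beta] per free digit pays for the prescribed digits. *)
Lemma orbit_dist y z n : 0 < y <= 1 -> 0 < z <= 1 ->
  (forall i, (0 < i <= n)%N -> orbit_digit y i = orbit_digit z i) ->
  `|y - z| <= 2 `^ (- (t * (dsum (orbit_digit y) n)%:R)).
Proof.
move=> y01 z01 /(orbit_contract y01 z01) /le_trans; apply.
rewrite -[leRHS]mulr1; apply: ler_pM; rewrite ?powR_ge0 ?normr_ge0//.
  rewrite ler_pow2 lerN2; apply: ler_wpM2l; first exact: ltW.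
  by rewrite lerDr subr_ge0 budget_le.
have := orbit01 n y01; have := orbit01 n z01; rewrite ler_norml; lra.
Qed.

(** After the [n] common digits, [orbit_dist] bounds the distance of [y] and [z] from above and
    [expansion_gap] that of their images from below, both through [dsum] at [n]. *)
Lemma orbit_point_holder y z : 0 < y <= 1 -> 0 < z <= 1 ->
  `|y - z| <= 2 `^ (t * (M + M).+2%:R) * `|orbit_point y - orbit_point z| `^ t.
Proof.
move=> y01 z01; have [->|yz] := eqVneq y z.
  by rewrite !subrr normr0 mulr_ge0 ?powR_ge0.
have /existsNP[k /eqP ykzk] : ~ forall k, orbit_digit y k.+1 = orbit_digit z k.+1.
  move=> eq_yz.
  have yz0 : 0 < `|y - z| by rewrite normr_gt0 subr_eq0.
  have [N Nyz] := exp_small (powR_ge0 2 (- t)) (pow2N_lt1 t0) yz0.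
  have : `|y - z| <= 2 `^ (- (t * (dsum (orbit_digit y) N)%:R)).
    by apply: orbit_dist => // -[].
  apply/negP; rewrite -ltNge (le_lt_trans _ (Nyz _ (leqnn N)))//.
  rewrite pow2X ler_pow2 mulNr lerN2; apply: ler_wpM2l; first exact: ltW.
  by rewrite ler_nat; apply: leq_dsum => i _; exact: orbit_digit_gt0.
have ex_diff : exists k, orbit_digit y k.+1 != orbit_digit z k.+1 by exists k.
case: (ex_minnP ex_diff) => n ynzn nmin {k ykzk ex_diff}.
have agree i : (0 < i <= n)%N -> orbit_digit y i = orbit_digit z i.
  case: i => // i /andP[_ lt_in]; apply/eqP; apply: contraTT lt_in => /nmin.
  by rewrite -leqNgt.
(* Prescribed digits do not depend on the point, so the disagreement is at a free position. *)
have free : ~~ forced beta m n.+1.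
  by apply: contraNN ynzn => fn; rewrite /orbit_digit fn.
(* The following digit is free, hence at most [M], or prescribed, hence greater than 1 for every
   point: the two cases of [expansion_gap]. *)
have next w : 0 < w <= 1 ->
    (orbit_digit w n.+2 <= M)%N \/ (forall v, 1 < orbit_digit v n.+2)%N.
  move=> w01; have [fn|nfn] := boolP (forced beta m n.+2).
    by right=> v; rewrite /orbit_digit fn.
  by left; exact: orbit_digit_free.
have gap v w : 0 < w <= 1 ->
    (forall i, (0 < i <= n)%N -> orbit_digit v i = orbit_digit w i) ->
    (orbit_digit w n.+1 < orbit_digit v n.+1)%N ->
    2^-1 ^+ (dsum (orbit_digit v) n + (M + M).+2) <= `|orbit_point v - orbit_point w|.
  move=> w01 vw lt_wv; rewrite distrC; apply: le_trans (ler_norm _).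
  apply: expansion_gap (orbit_point_expansion v) (orbit_point_expansion w) vw lt_wv _ _.
    exact: orbit_digit_free.
  by have [|/(_ v)] := next w w01; [left|right].
have {}gap : 2^-1 ^+ (dsum (orbit_digit y) n + (M + M).+2) <= `|orbit_point y - orbit_point z|.
  move: ynzn; rewrite neq_ltn => /orP[lt_yz|]; last exact: gap.
  by rewrite distrC (eq_dsum agree); apply: gap => // i /agree.
apply: le_trans (orbit_dist y01 z01 agree) _.
have /(ler_wpM2l (powR_ge0 2 (t * (M + M).+2%:R))) :
    2 `^ (- (t * (dsum (orbit_digit y) n + (M + M).+2)%:R))
    <= `|orbit_point y - orbit_point z| `^ t.
  by rewrite mulrC -mulNr powRrM -half_expE ge0_ler_powR ?nnegrE// ltW// half_exp_gt0.
apply: le_trans; rewrite -pow2D ler_pow2 natrD; lra.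
Qed.

End HolderPoints.

(** * Lower limits of extended real sequences *)

Section LimInf.
Context {R : realType}.
Implicit Types (u : (\bar R)^nat) (b : \bar R).

Lemma limn_einfE u : limn_einf u = ereal_sup (range (einfs u)).
Proof. by rewrite limn_einf_lim; apply/cvg_lim => //; exact: cvg_einfs_sup. Qed.

Lemma lt_limn_einf u b : (b < limn_einf u)%E ->
  exists N, forall n, (N <= n)%N -> (b < u n)%E.
Proof.
rewrite limn_einfE => /ereal_sup_gt[_ [N _ <-] bN]; exists N => n Nn.
by apply: (lt_le_trans bN); apply: ereal_inf_lbound; exists n.
Qed.

Lemma limn_einf_lt u b : (limn_einf u < b)%E ->
  forall N, exists2 n, (N <= n)%N & (u n < b)%E.
Proof.
rewrite limn_einfE => ub N.
have : (einfs u N < b)%E.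
  by apply: le_lt_trans ub; apply: ereal_sup_ubound; exists N.
by move=> /ereal_inf_lt[_ [n Nn <-] unb]; exists n.
Qed.

Lemma limn_einf_ge u b : (forall n, (b <= u n)%E) -> (b <= limn_einf u)%E.
Proof.
move=> bu; rewrite limn_einfE; apply: (@le_trans _ _ (einfs u 0)).
  by apply: le_ereal_inf_tmp => _ [n _ <-].
by apply: ereal_sup_ubound; exists 0%N.
Qed.

End LimInf.

Lemma unbounded_infinite_set (A : set nat) :
  (forall N, exists2 n, (N < n)%N & A n) -> infinite_set A.
Proof.
move=> unbA /finite_seqP[s As].
have [n] := unbA (\max_(i <- s) i); rewrite As ltnNge => /negP + /= ns; apply.
exact: (@leq_bigmax_seq _ _ xpredT id).
Qed.

Section LowerBound.
Context {R : realType}.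

Lemma digit_weights_sum_ge1 (t b : R) : 0 < t -> 1 < dim_fun b t ->
  exists M, 1 <= \sum_(0 <= j < M) digit_weight t b j.
Proof.
move=> t0; rewrite /dim_fun; set P := 2 `^ (- ((b + 1) * t)) => P1.
have q1 := pow2N_lt1 t0.
have P0 : 0 < P by exact: pow2_gt0.
(* With [q = 2^-t], the truncated sum [P (1 - q^M) / (1 - q)] reaches 1 once [q^M] is below this
   quantity. *)
have e0 : 0 < (P - (1 - 2 `^ (- t))) / P by rewrite divr_gt0//; lra.
have [M /(_ M (leqnn M)) qM] := exp_small (powR_ge0 2 (- t)) q1 e0.
exists M; rewrite sum_digit_weight// -/P ler_pdivlMr ?subr_gt0// mul1r.
by move: qM; rewrite ltr_pdivlMr// mulrBr mulr1 [P * _]mulrC; lra.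
Qed.

Lemma limsup_digits_holder (phi : nat -> R) (t beta alpha : R) :
  (forall n, (0 < n)%N -> 0 < phi n) -> 0 < t -> 0 <= beta -> alpha < beta ->
  1 < dim_fun beta t ->
  (forall N, exists2 n, (N <= n)%N & phi n < alpha * n%:R) ->
  exists C (g : R -> R), [/\ 0 <= C,
    forall y : R, 0 < y <= 1 -> limsup_digits phi (g y) &
    forall y z : R, 0 < y <= 1 -> 0 < z <= 1 -> `|y - z| <= C * `|g y - g z| `^ t].
Proof.
move=> phi0 t0 beta0 ab dim1 phile.
(* One unit lifts the truncation above [phi n]; the other makes the digit greater than 1, as the gap
   estimate requires. *)
pose m n := (Num.trunc (phi n)).+2.
have phim n : phi n <= (m n)%:R.
  by rewrite ltW// (lt_trans (truncnS_gt _))// ltr_nat.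
have mphi n : (0 < n)%N -> (m n)%:R <= phi n + 2.
  move=> /phi0/ltW/truncn_itv/andP[+ _].
  by rewrite /m -addn2 natrD lerD2r.
have [M /weighted_expansion] := digit_weights_sum_ge1 t0 dim1.
case=> [j|J [T JT]]; first exact: pow2_gt0.
have m1 n : (1 < m n)%N by [].
exists (2 `^ (t * (M + M).+2%:R)), (orbit_point beta m J T); split.
- exact: powR_ge0.
- move=> y y01; have ye := orbit_point_expansion beta J T m1 y.
  split.
    have := expansion_bounds ye 0; rewrite /psum /dsum !big_geq// add0r expr0.
    by [].
  apply: unbounded_infinite_set => N.
  have [|n Nn fn] := forced_unbounded (m := m) beta0 _ N.
    move=> {}N c.
    (* The excess [(beta - alpha) n] must absorb [c] and the 2 lost in rounding [phi n] up to
       [m n]. *)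
    have [K cK] : exists K : nat, (2 + c) / (beta - alpha) <= K%:R.
      by eexists; exact/ltW/truncnS_gt.
    have [n Nn phin] := phile (N + K).+1; exists n; first lia.
    have n0 : (0 < n)%N by lia.
    have := mphi n n0; move: cK; rewrite ler_pdivrMr ?subr_gt0// => cK.
    have : K%:R * (beta - alpha) <= n%:R * (beta - alpha).
      by apply: ler_wpM2r; [rewrite subr_ge0 ltW|rewrite ler_nat; lia].
    by move: phin cK; lra.
  have n0 : (0 < n)%N by lia.
  exists n => //; split=> //.
  by rewrite (digit_expansion ye n0) /orbit_digit fn.
- by move=> y z; exact: orbit_point_holder.
Qed.

End LowerBound.

Theorem theorem1p2 (R : realType) (phi : nat -> R)
    (phi_gt0 : forall n, (0 < n)%N -> 0 < phi n) :
  let alpha : \bar R := limn_einf (fun n => (phi n / n%:R)%:E) in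
  [/\ (0 <= alpha)%E,
      forall a : R, 0 <= a -> exists! s : R, dim_equation a s,
      forall a s : R, alpha = a%:E -> dim_equation a s ->
        hausdorff_dim (limsup_digits phi) = s%:E
    & alpha = +oo%E -> hausdorff_dim (limsup_digits phi) = 0%E].
Proof.
move=> alpha.
have alpha0 : (0 <= alpha)%E.
  (* At index 0 the quotient is 0, since the inverse of 0 is 0. *)
  apply: limn_einf_ge => -[|n]; first by rewrite invr0 mulr0.
  by rewrite lee_fin divr_ge0// ltW// phi_gt0.
have null t b : 0 < t -> (b%:E < alpha)%E -> dim_fun b t < 1 ->
    hausdorff_measure t (limsup_digits phi) = 0%E.
  move=> t0 /lt_limn_einf[N Nb] dimb; apply: (limsup_digits_null t0 dimb phi_gt0).
  exists N.+1 => n Nn; have := Nb n (ltnW Nn).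
  by rewrite lte_fin ltr_pdivlMr ?ltr0n; [exact: ltW|lia].
split=> //; first exact: dim_equation_exists.
  move=> a s alphaE; move: alpha0; rewrite alphaE lee_fin => a0.
  move=> /(dim_equationP _ a0)[s0 dims].
  (* This parameter [b] satisfies [(b + 1) t = (a + 1) s], so only the second term of [dim_fun]
     changes when [s] becomes [t]. *)
  have scale t : t != 0 -> dim_fun ((a + 1) * s / t - 1) t = 2 `^ (- ((a + 1) * s)) + 2 `^ (- t).
    by move=> tn0; rewrite /dim_fun subrK divfK.
  apply/eqP; rewrite eq_le; apply/andP; split.
    apply: hausdorff_dim_le => [|t st]; first exact: ltW.
    have t0 : 0 < t by exact: lt_trans st.
    apply: (null _ ((a + 1) * s / t - 1)) => //.
      rewrite alphaE lte_fin ltrBlDr ltr_pdivrMr// ltr_pM2l//; lra.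
    by rewrite scale ?gt_eqF// -[ltRHS]dims ltrD2l ltr_pow2 ltrN2.
  apply: hausdorff_dim_ge => // t /andP[t0 ts].
  pose beta := (a + 1) * s / t - 1.
  have abeta : a < beta.
    by rewrite /beta ltrBrDr ltr_pdivlMr// ltr_pM2l//; lra.
  (* The midpoint exceeds the lower limit, so [phi n] is below that multiple of [n] infinitely
     often, and it leaves a gap to [beta]. *)
  apply: (@limsup_digits_holder _ phi t beta ((a + beta) / 2)) => //; [lra|lra| |].
    by rewrite scale ?gt_eqF// -[ltLHS]dims ltrD2l ltr_pow2 ltrN2.
  have /limn_einf_lt inf : (alpha < ((a + beta) / 2)%:E)%E by rewrite alphaE lte_fin; lra.
  move=> N; have [n Nn p] := inf N.+1; exists n; first exact: ltnW.
  by move: p; rewrite lte_fin ltr_pdivrMr ?ltr0n// (leq_ltn_trans _ Nn).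
move=> alphaE; apply/eqP; rewrite eq_le hausdorff_dim_ge0 andbT.
apply: hausdorff_dim_le => // t t0.
have q0 : 0 < 1 - 2 `^ (- t) by rewrite subr_gt0 pow2N_lt1.
(* Every real [b] lies below an infinite lower limit; choosing [(b + 1) t = N] makes the first term
   of [dim_fun] equal to [2^-N], less than [1 - 2^-t]. *)
have [N /(_ N (leqnn N))] := @exp_small R 2^-1 _ ltac:(lra) ltac:(lra) q0.
rewrite half_expE => Nq; apply: (null _ (N%:R / t - 1)) => //; first by rewrite alphaE ltry.
by rewrite /dim_fun subrK divfK ?gt_eqF//; lra.
Qed.
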